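(* Let $\mathcal{F}$ be a nonempty family of graphs with $\chi(\mathcal{F})=r+1\geq 3$, and let $0\leq \alpha\leq 1-\frac{1}{r}$. Then, as $n\to\infty$, $$\mathrm{ex}_{\alpha}(n,\mathcal{F})=\left(1-\frac{1}{r}+o(1)\right)n.$$
   Context: All graphs are finite and simple. For a graph $G$, $A(G)$ is its adjacency matrix, $D(G)$ the diagonal matrix of vertex degrees, and for $0\le\alpha<1$, $A_\alpha(G)=\alpha D(G)+(1-\alpha)A(G)$; the $\alpha$-spectral radius $\lambda_\alpha(G)$ is the largest eigenvalue of $A_\alpha(G)$. For a family $\mathcal{F}$ of graphs, $\chi(\mathcal{F})=\min_{F\in\mathcal{F}}\chi(F)$, where $\chi$ is the chromatic number. A graph is $\mathcal{F}$-free if it contains no member of $\mathcal{F}$ as a (not necessarily induced) subgraph. $\mathrm{ex}_\alpha(n,\mathcal{F})$ denotes the maximum of $\lambda_\alpha(G)$ over all $\mathcal{F}$-free graphs $G$ on $n$ vertices. *)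

(* Defs.v *)
From HB Require Import structures.
From mathcomp Require Import all_boot all_order all_algebra.
From mathcomp Require Import classical_sets reals topology normedtype sequences.
Set Implicit Arguments. Unset Strict Implicit. Unset Printing Implicit Defensive.
Import Order.TTheory GRing.Theory Num.Theory.

Record graph := Graph {
  gv : nat;
  gadj : rel 'I_gv;
  gsym : symmetric gadj;
  girr : irreflexive gadj }.

Definition contains (G H : graph) : Prop :=
  exists f : 'I_(gv H) -> 'I_(gv G),
    injective f /\ forall i j, gadj i j -> gadj (f i) (f j).

Definition F_free (fam : graph -> Prop) (G : graph) : Prop :=
  forall H, fam H -> ~ contains G H.

Definition colorable (G : graph) (k : nat) : bool :=
  [exists c : {ffun 'I_(gv G) -> 'I_k},
     [forall i, forall j, gadj i j ==> (c i != c j)]].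

Lemma colorable_ex (G : graph) : exists k, colorable G k.
Proof.
exists (gv G); apply/existsP; exists [ffun i => i].
apply/forallP => i; apply/forallP => j; apply/implyP => hij.
rewrite !ffunE; apply/eqP => eij; subst j.
by rewrite (@girr G i) in hij.
Qed.

Definition chi (G : graph) : nat := ex_minn (colorable_ex G).

Local Open Scope ring_scope.
Local Open Scope classical_set_scope.

Section Spectral.
Variable R : realType.

Definition adjmx (G : graph) : 'M[R]_(gv G) :=
  \matrix_(i, j) (gadj i j)%:R.

Definition degmx (G : graph) : 'M[R]_(gv G) :=
  diag_mx (\row_i \sum_j adjmx G i j).

Definition Aalpha (alpha : R) (G : graph) : 'M[R]_(gv G) :=
  alpha *: degmx G + (1 - alpha) *: adjmx G.

Definition lambda_alpha (alpha : R) (G : graph) : R :=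
  sup [set a : R | eigenvalue (Aalpha alpha G) a].

Definition ex_alpha (alpha : R) (n : nat) (fam : graph -> Prop) : R :=
  sup [set lambda_alpha alpha G | G in [set G : graph | gv G = n /\ F_free fam G]].

End Spectral.

(* Main.v *)
(* The lower bound comes from an r-partite graph with r equal classes of size
   floor(n/r), completed by isolated vertices.

   For the upper bound let theta(S) be the maximum of the quadratic form of A_alpha
   on the unit vectors supported by a vertex set S of size m, attained at a
   nonnegative x, which satisfies the eigenvalue equation on S.  If the least entry of
   x is close to 1/sqrt m, then x is nearly constant and every degree in S is at
   least theta(S) - eta m.  Otherwise deleting a vertex with the least entry
   increases theta(S)/m by at least kappa/m; this uses theta(S)/m >= alpha + eps,
   whence the condition alpha <= 1 - 1/r.  As theta(S)/m <= 1 and the harmonic series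
   diverges, a large graph with theta > (1 - 1/r + eps) n has a large subset of the
   first kind, and the minimum degree form of the Erdos-Stone theorem yields a complete
   (r+1)-partite subgraph with large classes, which contains every (r+1)-colourable
   graph of bounded order. *)
Require Import Defs.
From HB Require Import structures.
From mathcomp Require Import all_boot all_order all_algebra.
From mathcomp Require Import classical_sets reals topology normedtype sequences.
From mathcomp Require Import derive lra.
Import Order.TTheory GRing.Theory Num.Theory.
Import numFieldNormedType.Exports.
Set Implicit Arguments. Unset Strict Implicit. Unset Printing Implicit Defensive.
Local Open Scope ring_scope.
Local Open Scope classical_set_scope.

(** * Pigeonhole, complete multipartite subgraphs and the Erdos-Stone theorem *)

Lemma pigeonhole_subset (T U : finType) (f : T -> U) (A : {set T}) (V : {set U})
    (t : nat) :
  (forall x, x \in A -> f x \in V) -> (#|V| * t < #|A|)%N ->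
  exists2 y, y \in V & (t < #|[set x in A | f x == y]|)%N.
Proof.
move=> fV lt_A.
suff /exists_inP[y yV ty] :
    [exists y in V, (t < #|[set x in A | f x == y]|)%N] by exists y.
rewrite -[[exists y in V, _]]negbK negb_exists_in; apply/negP => /forall_inP small.
move: lt_A; rewrite ltnNge => /negP; apply.
rewrite -sum1_card (partition_big f (mem V)) //= -sum_nat_const.
apply: leq_sum => y yV; rewrite sum1dep_card.
by have := small y yV; rewrite -leqNgt; congr (_ <= _)%N; apply: eq_card => x; rewrite !inE.
Qed.

Lemma exists_subset_card (T : finType) (A : {set T}) (t : nat) :
  (t <= #|A|)%N -> exists2 B : {set T}, B \subset A & #|B| = t.
Proof.
move=> tA; exists [set x in take t (enum A)].
  by apply/fintype.subsetP => x; rewrite inE => /mem_take; rewrite mem_enum.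
rewrite cardsE; move/card_uniqP: (take_uniq t (enum_uniq A)) => ->.
by rewrite size_takel // -cardE.
Qed.

(** The classes of a complete k-partite subgraph; irreflexivity of [e] makes them disjoint, and
    edges inside a class are allowed. *)
Definition blowup_in (T : finType) (e : rel T) (S : {set T}) (k t : nat)
    (B : nat -> {set T}) : Prop :=
  (forall i, (i < k)%N -> B i \subset S /\ #|B i| = t) /\
  (forall i j, (i < j < k)%N -> forall u w, u \in B i -> w \in B j -> e u w).

Lemma blowup_adj (T : finType) (e : rel T) (S : {set T}) (k t : nat) B :
  symmetric e -> blowup_in e S k t B ->
  forall i j, (i < k)%N -> (j < k)%N -> i != j ->
  forall u w, u \in B i -> w \in B j -> e u w.
Proof.
move=> esym [_ adj] i j ik jk; rewrite neq_ltn => /orP[] ij u w uB wB.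
  by apply: adj uB wB; rewrite ij.
by rewrite esym; apply: adj wB uB; rewrite ij.
Qed.

Definition degree_in {T : finType} (e : rel T) (S : {set T}) (u : T) : nat :=
  #|[set v in S | e u v]|.

(** The neighbourhood of a vertex in the union of the classes takes at most 2^(k*s) values. Hence t
    of the counted vertices share one trace [Z]; they form the new class, and every old class
    shrinks to t vertices of its intersection with [Z]. *)
Lemma blowup_extend (T : finType) (e : rel T) (S : {set T}) (k s t : nat) B :
  symmetric e -> blowup_in e S k s B ->
  (2 ^ (k * s) * t <
     #|[set u in S | [forall i : 'I_k, t <= #|B i :&: [set w | e u w]|]]|)%N ->
  exists B', blowup_in e S k.+1 t B'.
Proof.
move=> esym [Bs adj] bigU.
pose K := (\bigcup_(i < k) B i)%SET.
have cardK : (#|K| <= k * s)%N.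
  have -> : (k * s = \sum_(i < k) s)%N by rewrite sum_nat_const card_ord.
  rewrite /K; elim/big_ind2: _ => [|A m A' m' Am Am'|i _]; first by rewrite cards0.
    exact: leq_trans (leq_card_setU _ _) (leq_add Am Am').
  by have [_ ->] := Bs i (ltn_ord i).
pose nbrK u : {set T} := (K :&: [set w | e u w])%SET.
have [Z ZK tZ] : exists2 Z, Z \in powerset K &
    (t < #|[set u in [set u in S | [forall i : 'I_k, t <= #|B i :&: [set w | e u w]|]] |
            nbrK u == Z]|)%N.
  apply: pigeonhole_subset.
    by move=> u _; rewrite powersetE finset.subsetIl.
  apply: leq_ltn_trans bigU.
  by rewrite card_powerset leq_mul2r leq_exp2l // cardK orbT.
have [C CZ cardC] := exists_subset_card (ltnW tZ).
have C_U u : u \in C -> [/\ u \in S, nbrK u = Z &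
    forall i, (i < k)%N -> (t <= #|B i :&: Z|)%N].
  move=> /(fintype.subsetP CZ); rewrite !inE => /andP[/andP[uS /forallP hU] /eqP uZ].
  split=> // i ik; apply: leq_trans (hU (Ordinal ik)) _ => /=.
  apply: subset_leq_card; apply/fintype.subsetP => w; rewrite !inE => /andP[wB uw].
  rewrite wB -uZ !inE uw andbT; apply/bigcupP; by exists (Ordinal ik).
case: (posnP t) => [t0|t_gt0].
  exists (fun _ => finset.set0); rewrite t0; split=> [i _|i j _ u w]; last by rewrite inE.
  by rewrite finset.sub0set cards0.
have [u0 u0C] : exists u, u \in C by apply/card_gt0P; rewrite cardC.
have [_ _ largeZ] := C_U _ u0C.
have choice_B i : exists D : {set T}, (i < k)%N -> D \subset (B i :&: Z)%SET /\ #|D| = t.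
  case: (ltnP i k) => [ik|_]; last by exists finset.set0.
  by have [D DBZ cardD] := exists_subset_card (largeZ i ik); exists D.
have [D DP] := boolp.choice choice_B.
exists (fun i => if (i < k)%N then D i else C); split=> [i|i j /andP[ij]].
  rewrite ltnS leq_eqVlt; case: ltnP => [ik _|_ _]; last first.
    by split=> //; apply/fintype.subsetP => u /C_U[].
  have [DBZ cardD] := DP i ik; split=> //.
  have [BS _] := Bs i ik; exact: fintype.subset_trans DBZ (fintype.subset_trans (subsetIl _ _) BS).
rewrite ltnS leq_eqVlt => jk u w.
have ik : (i < k)%N by case/predU1P: jk => [<-//|]; apply: ltn_trans.
have [/fintype.subsetP DBZ _] := DP i ik.
rewrite ik; case: ltnP jk => [jk _ /DBZ|kj _ /DBZ].
  have [/fintype.subsetP DBZj _] := DP j jk.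
  rewrite inE => /andP[uB _] /DBZj; rewrite inE => /andP[wB _].
  by apply: adj uB wB; rewrite ij.
rewrite inE => /andP[_ uZ] /C_U[_ Zw _]; move: uZ; rewrite -Zw !inE esym.
by case/andP.
Qed.

Lemma card_setI_sum (T : finType) (A : {set T}) (P : pred T) :
  (#|A :&: [set w | P w]| = \sum_(w in A) P w)%N.
Proof.
rewrite -sum1_card big_mkcond [RHS]big_mkcond /=; apply: eq_bigr => w _.
by rewrite !inE; case: (w \in A); case: (P w).
Qed.

Lemma sum_degree_blowup (T : finType) (e : rel T) (S : {set T}) (k : nat) B :
  symmetric e ->
  (\sum_(u in S) \sum_(i < k) #|B i :&: [set w | e u w]|
   = \sum_(i < k) \sum_(w in B i) degree_in e S w)%N.
Proof.
move=> esym; rewrite exchange_big /=; apply: eq_bigr => i _.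
rewrite (eq_bigr _ (fun u _ => card_setI_sum (B i) (e u))) exchange_big /=.
apply: eq_bigr => w _; rewrite /degree_in.
have -> : [set v in S | e w v] = (S :&: [set v | e w v])%SET.
  by apply/setP => v; rewrite !inE.
by rewrite card_setI_sum; apply: eq_bigr => u _; rewrite esym.
Qed.

(** Both sides are compared with the number of edges between [S] and the classes: a vertex with
    fewer than t neighbours in some class contributes at most (k-1)*s + t, any other at most k*s. *)
Lemma blowup_popular (R : numDomainType) (T : finType) (e : rel T) (S : {set T})
    (k s t : nat) (d : R) B :
  symmetric e -> blowup_in e S k s B ->
  (forall u, u \in S -> d <= (degree_in e S u)%:R) ->
  (k * s)%:R * d <=
    (#|[set u in S | [forall i : 'I_k, t <= #|B i :&: [set w | e u w]|]]%N| * (k * s)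
     + #|S| * (k.-1 * s + t))%:R.
Proof.
move=> esym [Bs adj] degS; set U := [set u in S | _].
apply: (@le_trans _ _ (\sum_(i < k) \sum_(w in B i) degree_in e S w)%:R).
  have -> : (k * s)%:R * d = \sum_(i < k) \sum_(w in B i) d.
    rewrite (eq_bigr (fun=> d *+ s)) => [|i _].
      by rewrite sumr_const card_ord -mulrnA mulr_natl mulnC.
    by have [_ cardB] := Bs i (ltn_ord i); rewrite sumr_const cardB.
  rewrite natr_sum; apply: ler_sum => i _; rewrite natr_sum.
  apply: ler_sum => w wB; apply: degS.
  by have [/fintype.subsetP BS _] := Bs i (ltn_ord i); exact: BS.
rewrite ler_nat.
rewrite -sum_degree_blowup //.
apply: (@leq_trans (\sum_(u in S) ((u \in U) * (k * s) + (k.-1 * s + t)))%N); last first.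
  rewrite big_split /= sum_nat_const leq_add2r -big_distrl /= leq_mul2r.
  rewrite -(card_setI_sum S (mem U)) subset_leq_card ?orbT //.
  by apply/fintype.subsetP => w /setIP[_]; rewrite inE.
have card_le (u : T) (i : 'I_k) : (#|B i :&: [set w | e u w]| <= s)%N.
  have [_ <-] := Bs i (ltn_ord i).
  by apply: subset_leq_card; apply: finset.subsetIl.
apply: leq_sum => u uS; have [uU|] := boolP (u \in U).
  rewrite mul1n; apply: leq_trans (leq_addr _ _).
  by rewrite -[X in (_ <= X * _)%N](card_ord k) -sum_nat_const leq_sum.
rewrite inE uS negb_forall => /existsP[i0]; rewrite -ltnNge => /ltnW small.
rewrite mul0n add0n addnC (bigD1 i0) //= leq_add //.
rewrite (_ : k.-1 * s = \sum_(i < k | i != i0) s)%N ?leq_sum //.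
by rewrite sum_nat_const cardC1 card_ord.
Qed.

Lemma exists_nat_mul_ge (R : archiRealFieldType) (eps x : R) :
  0 < eps -> exists n : nat, x <= eps * n%:R.
Proof.
move=> eps_gt0; exists (Num.bound `|x / eps|).
rewrite mulrC -ler_pdivrMr //; apply: le_trans (ler_norm _) (ltW _).
exact: archi_boundP.
Qed.

(* Counting the edges between [S] and a complete k-partite graph with classes of size
   s >> t / eps, linearly many vertices of [S] have t neighbours in every class; by
   pigeonhole t of them have the same neighbourhood in it and form a new class. *)
Lemma erdos_stone_min_degree (R : realType) (r : nat) (eps : R) :
  (0 < r)%N -> 0 < eps -> forall k t : nat, (k <= r.+1)%N ->
  exists m0 : nat, forall (T : finType) (e : rel T) (S : {set T}),
    symmetric e -> (m0 <= #|S|)%N ->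
    (forall u, u \in S -> (1 - r%:R^-1 + eps) * #|S|%:R <= (degree_in e S u)%:R) ->
    exists B, blowup_in e S k t B.
Proof.
move=> r_gt0 eps_gt0; elim=> [|k IHk] t kr.
  exists 0%N => T e S _ _ _; exists (fun=> finset.set0).
  by split=> [i|i j /andP[]].
have [s s_big] : exists s : nat, 2 * t%:R + 1 <= eps * s%:R.
  exact: exists_nat_mul_ge.
have [m1 hm1] := IHk s (ltnW kr).
pose c := (2 ^ (k * s) * t)%N.
have [m2 m2_big] : exists m2 : nat, 2 * (c.+1)%:R <= eps * m2%:R.
  exact: exists_nat_mul_ge.
exists (m1 + m2 + c.+1)%N => T e S esym mS degS.
have [|B blB] := hm1 T e S esym _ degS; first by apply: leq_trans mS; rewrite -addnA leq_addr.
apply: (blowup_extend (t := t) esym blB).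
have := blowup_popular t esym blB degS; set U := [set u in S | _] => popular.
(* With no classes yet every vertex of [S] qualifies, so |S| > c is enough. *)
rewrite -/c; case: k => [|k] in IHk kr hm1 c m2_big mS blB U popular *.
  rewrite [U](_ : _ = S) ?(leq_trans _ mS) // ?leq_addl //.
  by apply/setP => u; rewrite inE andbC; case: forallP => // -[] [].
(* There are now k+1 classes; let N be the size of [S]. If at most c vertices qualify, (k+1)/r <= 1
   reduces the edge count to eps (k+1) s N <= c (k+1) s + N t. This contradicts t < eps s / 2 and c
   < eps N / 2, which hold by the choice of s and m2. *)
rewrite ltnNge; apply/negP => Uc.
have N_big : 2 * (c.+1)%:R <= eps * #|S|%:R.
  apply: le_trans m2_big _; rewrite ler_pM2l // ler_nat; apply: leq_trans mS.
  by rewrite (addnC m1) -addnA leq_addr.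
move: popular; rewrite natrD !natrM natrD natrM /=.
have Uc' : #|U|%:R <= c%:R :> R by rewrite ler_nat.
have k_le : k.+1%:R * r%:R^-1 <= 1 :> R.
  by rewrite ler_pdivrMr ?ltr0n // mul1r ler_nat.
move: k_le s_big N_big Uc' eps_gt0.
have N_gt0 : 0 < #|S|%:R :> R by rewrite ltr0n; apply: leq_trans mS; rewrite addnS.
move: N_gt0; have := ler0n R s.
rewrite -[c.+1%:R]natr1; have -> : k.+1%:R = k%:R + 1 :> R by rewrite natr1.
have := ler0n R k.
move: (#|U|%:R) (#|S|%:R) (s%:R) (k%:R) (t%:R : R) (c%:R : R) (r%:R^-1) => {}u N s' k' t' c' r'.
move=> k_ge0 s_ge0 N_gt0 k_le s_big N_big uc eps0 H.
have h1 : (k' + 1) * r' * (s' * N) <= s' * N.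
  by apply: ler_piMl => //; apply: mulr_ge0 => //; apply: ltW.
have h2 : N * t' <= N * ((eps * s' - 1) / 2).
  by apply: ler_wpM2l; [exact: ltW|lra].
have h3 : u * ((k' + 1) * s') <= c' * ((k' + 1) * s').
  by apply: ler_wpM2r => //; apply: mulr_ge0 => //; lra.
have h4 : (2 * (c' + 1)) * ((k' + 1) * s') <= (eps * N) * ((k' + 1) * s').
  by apply: ler_wpM2r => //; apply: mulr_ge0 => //; lra.
have h5 : 0 <= (eps * N * s') * k' by rewrite !mulr_ge0 // ltW.
have h6 : 0 <= k' * s' by rewrite mulr_ge0.
lra.
Qed.

(** * The quadratic form of A_alpha on a vertex set *)

Definition sqnorm {R : realType} {T : finType} (S : {set T}) (x : T -> R) : R :=
  \sum_(i in S) x i ^+ 2.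

(** For i in [S], entry i of A_alpha of the induced subgraph on [S], applied to x. With the vertex
    type fixed, deleting a vertex changes [S] alone. *)
Definition alpha_op {R : realType} {T : finType} (e : rel T) (alpha : R)
    (S : {set T}) (x : T -> R) (i : T) : R :=
  \sum_(j in S) (e i j)%:R * (alpha * x i + (1 - alpha) * x j).

Definition alpha_form {R : realType} {T : finType} (e : rel T) (alpha : R)
    (S : {set T}) (x : T -> R) : R :=
  \sum_(i in S) x i * alpha_op e alpha S x i.

Lemma alpha_op_sym (R : realType) (T : finType) (e : rel T) (alpha : R)
    (S : {set T}) (x y : T -> R) :
  symmetric e ->
  \sum_(i in S) y i * alpha_op e alpha S x i =
  \sum_(i in S) x i * alpha_op e alpha S y i.
Proof.
move=> esym.
have split_sum (u v : T -> R) : \sum_(i in S) v i * alpha_op e alpha S u i =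
    \sum_(i in S) \sum_(j in S) (e i j)%:R * (alpha * (u i * v i)) +
    \sum_(i in S) \sum_(j in S) (e i j)%:R * ((1 - alpha) * (v i * u j)).
  rewrite -big_split; apply: eq_bigr => i _ /=.
  by rewrite -big_split mulr_sumr; apply: eq_bigr => j _ /=; lra.
rewrite !split_sum; congr (_ + _); last rewrite exchange_big /=.
  by apply: eq_bigr => i _; apply: eq_bigr => j _; rewrite (mulrC (x i)).
by apply: eq_bigr => i _; apply: eq_bigr => j _; rewrite esym (mulrC (x i)).
Qed.

Lemma alpha_op_add (R : realType) (T : finType) (e : rel T) (alpha : R)
    (S : {set T}) (x y : T -> R) (t : R) (i : T) :
  alpha_op e alpha S (fun j => x j + t * y j) i =
  alpha_op e alpha S x i + t * alpha_op e alpha S y i.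
Proof.
by rewrite /alpha_op mulr_sumr -big_split; apply: eq_bigr => j _ /=; lra.
Qed.

Lemma alpha_form_add (R : realType) (T : finType) (e : rel T) (alpha : R)
    (S : {set T}) (x y : T -> R) (t : R) :
  symmetric e ->
  alpha_form e alpha S (fun j => x j + t * y j) =
  alpha_form e alpha S x + 2 * t * (\sum_(i in S) y i * alpha_op e alpha S x i)
  + t ^+ 2 * alpha_form e alpha S y.
Proof.
move=> esym; have sym := alpha_op_sym alpha S x y esym.
rewrite -mulrA mulrDl !mul1r {2}sym /alpha_form !mulr_sumr -!big_split /=.
by apply: eq_bigr => i _; rewrite alpha_op_add; lra.
Qed.

Lemma sqnorm_add (R : realType) (T : finType) (S : {set T}) (x y : T -> R) (t : R) :
  sqnorm S (fun j => x j + t * y j) =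
  sqnorm S x + 2 * t * (\sum_(i in S) y i * x i) + t ^+ 2 * sqnorm S y.
Proof.
by rewrite /sqnorm !mulr_sumr -!big_split /=; apply: eq_bigr => i _; lra.
Qed.

Lemma sqnorm_scale (R : realType) (T : finType) (S : {set T}) (x : T -> R) (t : R) :
  sqnorm S (fun j => t * x j) = t ^+ 2 * sqnorm S x.
Proof. by rewrite mulr_sumr; apply: eq_bigr => i _; rewrite exprMn. Qed.

Lemma alpha_form_scale (R : realType) (T : finType) (e : rel T) (alpha : R)
    (S : {set T}) (x : T -> R) (t : R) :
  alpha_form e alpha S (fun j => t * x j) = t ^+ 2 * alpha_form e alpha S x.
Proof.
rewrite mulr_sumr; apply: eq_bigr => i _; rewrite /alpha_op !mulr_sumr.
by apply: eq_bigr => j _; lra.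
Qed.

Lemma eq_alpha_form (R : realType) (T : finType) (e : rel T) (alpha : R)
    (S : {set T}) (x y : T -> R) :
  {in S, x =1 y} -> alpha_form e alpha S x = alpha_form e alpha S y.
Proof.
move=> xy; apply: eq_bigr => i iS; rewrite (xy _ iS); congr (_ * _).
by apply: eq_bigr => j jS; rewrite !xy.
Qed.

Lemma eq_sqnorm (R : realType) (T : finType) (S : {set T}) (x y : T -> R) :
  {in S, x =1 y} -> sqnorm S x = sqnorm S y.
Proof. by move=> xy; apply: eq_bigr => i iS; rewrite xy. Qed.

Lemma sqnorm_ge0 (R : realType) (T : finType) (S : {set T}) (x : T -> R) :
  0 <= sqnorm S x.
Proof. by apply: sumr_ge0 => i _; apply: sqr_ge0. Qed.

Lemma sqr_le_sqnorm (R : realType) (T : finType) (S : {set T}) (x : T -> R) i :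
  i \in S -> x i ^+ 2 <= sqnorm S x.
Proof.
move=> iS; rewrite /sqnorm (bigD1 i) //= lerDl.
by apply: sumr_ge0 => j _; apply: sqr_ge0.
Qed.

Lemma continuous_sum (R : realType) (I : Type) (U : topologicalType)
    (r : seq I) (P : pred I) (f : I -> U -> R) :
  (forall i, continuous (f i)) -> continuous (fun x => \sum_(i <- r | P i) f i x).
Proof.
by move=> cf; apply: continuous_big => // x; apply: add_continuous.
Qed.

(** The Rayleigh quotient attains its maximum by compactness, and homogeneity carries the bound from
    unit vectors to all y; where [sqnorm] vanishes, y is zero on [S]. *)
Lemma alpha_form_max_exists (R : realType) (n : nat) (e : rel 'I_n) (alpha : R)
    (S : {set 'I_n}) :
  S != finset.set0 -> exists2 x : 'I_n -> R, sqnorm S x = 1 &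
    forall y, alpha_form e alpha S y <= alpha_form e alpha S x * sqnorm S y.
Proof.
move=> /set0Pn[i0 i0S].
pose f (v : 'rV[R]_n) := alpha_form e alpha S (v ord0).
pose g (v : 'rV[R]_n) := sqnorm S (v ord0).
have coord i : continuous (fun v : 'rV[R]_n => v ord0 i) by exact: coord_continuous.
have cont_g : continuous g.
  by apply: continuous_sum => i v; exact: (continuousM (coord i v) (coord i v)).
have cont_op i : continuous (fun v : 'rV[R]_n => alpha_op e alpha S (v ord0) i).
  apply: continuous_sum => j v.
  have nbhs_v : Filter (nbhs v) := nbhs_filter v.
  have cst (a : R) : (fun=> a) @ v --> a by apply: cvg_cst.
  exact: (cvgM (cst _) (cvgD (cvgM (cst _) (coord i v)) (cvgM (cst _) (coord j v)))).
have cont_f : continuous f.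
  by apply: continuous_sum => i v; exact: (cvgM (coord i v) (cont_op i v)).
(* The box provides boundedness, since [g] does not constrain the coordinates outside [S]. *)
pose A := [set v : 'rV[R]_n | forall i, `[(-1 : R), 1] (v ord0 i)] `&` [set v | g v = 1].
have compact_A : compact A.
  apply: compact_closedI.
    by apply: (@rV_compact _ _ (fun=> `[(-1 : R), 1])) => i; apply: segment_compact.
  have -> : [set v | g v = 1] = g @^-1` [set 1] by [].
  by move/continuous_closedP: cont_g; apply; exact: closed_eq.
have unit_vec (y : 'I_n -> R) : sqnorm S y = 1 ->
    exists2 v : 'rV[R]_n, A v & {in S, v ord0 =1 y}.
  move=> y1; exists (\row_i if i \in S then y i else 0); last by move=> i iS; rewrite mxE iS.
  split=> [i|] /=.
    rewrite mxE in_itv /= -ler_norml; case: ifP => iS; last by rewrite normr0.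
    by rewrite -(@ler_pXn2r _ 2) ?nnegrE // expr1n real_normK ?num_real // -y1 sqr_le_sqnorm.
  by rewrite /g -y1; apply: eq_sqnorm => i iS; rewrite mxE iS.
have [| |c cA maxc] := compact_EVT_max (f := f) _ compact_A _.
- have [|v vA _] := unit_vec (fun i => (i == i0)%:R); last by exists v.
  rewrite /sqnorm (bigD1 i0) //= eqxx expr1n big1 ?addr0 // => i /andP[_ /negbTE->].
  by rewrite expr0n.
- exact: continuous_subspaceT.
exists (c ord0); first by move: cA; rewrite inE => -[].
move=> y; have := sqnorm_ge0 S y; rewrite le_eqVlt => /predU1P[y0|y_gt0].
  rewrite -y0 mulr0 (@eq_alpha_form _ _ _ _ _ _ (fun i => 0 * y i)).
    by rewrite alpha_form_scale expr0n mul0r.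
  move=> i iS; rewrite mul0r; apply/eqP; rewrite -sqrf_eq0 eq_le sqr_ge0 andbT.
  by rewrite [leRHS]y0 sqr_le_sqnorm.
pose s := Num.sqrt (sqnorm S y).
have s_gt0 : 0 < s by rewrite sqrtr_gt0.
have s2 : s ^+ 2 = sqnorm S y by rewrite sqr_sqrtr // ltW.
have [|v vA vy] := unit_vec (fun i => s^-1 * y i).
  by rewrite sqnorm_scale -s2 -exprMn mulVf ?expr1n // gt_eqF.
have := maxc v; rewrite inE => /(_ vA); rewrite /f (eq_alpha_form _ _ vy) alpha_form_scale.
by rewrite exprVn s2 ler_pdivrMl // mulrC.
Qed.

(** The choice t = p / k with k = |c| + 1 > c gives (k - c) (p / k)^2 <= 0. *)
Lemma eq0_of_linear_le_quadratic (R : realType) (p c : R) :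
  (forall t, t * p <= t ^+ 2 * c) -> p = 0.
Proof.
move=> le_pc; pose k := `|c| + 1.
have k_gt0 : 0 < k by rewrite ltr_pwDr.
have pk : p = p / k * k by rewrite divfK // gt_eqF.
move: (p / k) pk (le_pc (p / k)) => q -> le_q.
have c_lt : c < k by rewrite /k (le_lt_trans (ler_norm c)) // ltrDl.
suff -> : q = 0 by rewrite mul0r.
apply/eqP; rewrite -sqrf_eq0 eq_le sqr_ge0 andbT.
by rewrite -(@pmulr_lle0 _ (k - c)) ?subr_gt0 //; lra.
Qed.

(** Since A_alpha has nonnegative entries, a maximiser may be replaced by its entrywise absolute
    value. The eigenvalue equation at u is then the first-order condition for moving along the basis
    vector of u. *)
Lemma perron_exists (R : realType) (n : nat) (e : rel 'I_n) (alpha : R)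
    (S : {set 'I_n}) :
  symmetric e -> 0 <= alpha <= 1 -> S != finset.set0 ->
  exists (x : 'I_n -> R) (a : R),
    [/\ forall i, 0 <= x i, sqnorm S x = 1,
        forall i, i \in S -> alpha_op e alpha S x i = a * x i &
        forall y, alpha_form e alpha S y <= a * sqnorm S y].
Proof.
move=> esym /andP[alpha_ge0 alpha_le1] S0.
have [x0 x01 maxx0] := alpha_form_max_exists e alpha S0.
set a := alpha_form e alpha S x0 in maxx0.
pose x i := `|x0 i|.
have x1 : sqnorm S x = 1.
  by rewrite -x01; apply: eq_bigr => i _; rewrite real_normK ?num_real.
have formx : alpha_form e alpha S x = a.
  apply/eqP; rewrite eq_le; apply/andP; split.
    by have := maxx0 x; rewrite x1 mulr1.
  apply: ler_sum => i _; rewrite !mulr_sumr; apply: ler_sum => j _.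
  rewrite !(mulrCA _ (_%:R)); apply: ler_wpM2l => //.
  rewrite !mulrDr !(mulrCA _ alpha) !(mulrCA _ (1 - alpha)).
  apply: lerD; apply: ler_wpM2l => //; rewrite ?subr_ge0 //.
    by rewrite /x -normrM ler_norm.
  by rewrite /x -normrM ler_norm.
exists x, a; split=> [i|//|u uS|//]; first exact: normr_ge0.
pose y i : R := (i == u)%:R.
have sum_y (z : 'I_n -> R) : \sum_(i in S) y i * z i = z u.
  rewrite (bigD1 u) //= /y eqxx mul1r big1 ?addr0 // => i /andP[_ /negbTE->].
  by rewrite mul0r.
apply/subr0_eq/(@eq0_of_linear_le_quadratic _ _
  ((a * sqnorm S y - alpha_form e alpha S y) / 2)) => t.
have := maxx0 (fun j => x j + t * y j).
rewrite alpha_form_add // sqnorm_add !sum_y x1 formx; lra.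
Qed.

(** * Vertex deletion and nearly constant eigenvectors *)

(** An edge between v and i contributes alpha x_i^2 + (1 - alpha) x_i x_v through row i, which
    exceeds its contribution through row v by alpha (x_i^2 - x_v^2). Hence the factor 2 and the last
    sum, which [sum_adj_le] controls when x_v is the least entry. *)
Lemma alpha_form_delete (R : realType) (T : finType) (e : rel T) (alpha : R)
    (S : {set T}) (x : T -> R) (v : T) :
  symmetric e -> irreflexive e -> v \in S ->
  alpha_form e alpha S x = alpha_form e alpha (S :\ v) x +
    2 * (x v * alpha_op e alpha S x v) +
    alpha * \sum_(i in S) (e v i)%:R * (x i ^+ 2 - x v ^+ 2).
Proof.
move=> esym eirr vS.
have op_v : alpha_op e alpha S x v =
    \sum_(j in S :\ v) (e v j)%:R * (alpha * x v + (1 - alpha) * x j).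
  by rewrite /alpha_op (big_setD1 v) //= eirr mul0r add0r.
rewrite [LHS](big_setD1 v) //= [\sum_(i in S) (e v i)%:R * _](big_setD1 v) //= eirr mul0r add0r.
suff -> : \sum_(i in S :\ v) x i * alpha_op e alpha S x i =
    alpha_form e alpha (S :\ v) x + x v * alpha_op e alpha S x v +
    alpha * \sum_(i in S :\ v) (e v i)%:R * (x i ^+ 2 - x v ^+ 2) by lra.
rewrite op_v /alpha_form !mulr_sumr -!big_split /=; apply: eq_bigr => i iS.
by rewrite /alpha_op (big_setD1 v) //= (esym i v); lra.
Qed.

Lemma sum_adj_le (R : realType) (T : finType) (e : rel T) (S : {set T}) (x : T -> R)
    (s : R) (u : T) :
  0 <= s -> (forall i, i \in S -> s <= x i) ->
  \sum_(i in S) (e u i)%:R * (x i ^+ 2 - s ^+ 2) <= sqnorm S x - #|S|%:R * s ^+ 2.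
Proof.
move=> s_ge0 sx.
rewrite mulr_natl -sumr_const -sumrB; apply: ler_sum => i iS.
rewrite ler_piMl ?lern1 ?leq_b1 // subr_ge0 ler_pXn2r ?nnegrE ?sx //.
exact: le_trans (sx i iS).
Qed.

Lemma degree_in_sum (R : realType) (T : finType) (e : rel T) (S : {set T}) (u : T) :
  (degree_in e S u)%:R = \sum_(i in S) (e u i)%:R :> R.
Proof.
rewrite -natr_sum -card_setI_sum; congr (_%:R).
by apply: eq_card => v; rewrite !inE.
Qed.

(** In the eigenvalue equation at u each neighbour i satisfies 2 s x_i <= (x_i^2 - s^2) + 2 s^2, and
    these differences sum to at most eta. With d the degree of u, dividing by 2 s x_u gives a <= d +
    eta / (2 s x_u), where 2 s x_u |S| >= 2 (1 - eta) >= 1. *)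
Lemma near_uniform_degree (R : realType) (T : finType) (e : rel T) (alpha eta a s : R)
    (S : {set T}) (x : T -> R) :
  0 <= alpha <= 1 -> 0 <= eta <= 1 / 2 -> 0 < s ->
  (forall i, i \in S -> s <= x i) -> sqnorm S x = 1 ->
  (forall i, i \in S -> alpha_op e alpha S x i = a * x i) ->
  1 - eta <= #|S|%:R * s ^+ 2 ->
  forall u, u \in S -> a - eta * #|S|%:R <= (degree_in e S u)%:R.
Proof.
move=> /andP[alpha_ge0 alpha_le1] /andP[eta_ge0 eta_le] s_gt0 sx x1 eig unif u uS.
have := sum_adj_le e u (ltW s_gt0) sx; rewrite x1 => adj_le.
have xu := sx u uS; have sxu : s ^+ 2 <= s * x u by rewrite expr2 ler_pM2l.
set d : R := (degree_in e S u)%:R.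
have d_ge0 : 0 <= d by apply: ler0n.
have key : 2 * s * (a * x u) <=
    2 * s * alpha * x u * d + (1 - alpha) * (2 * s ^+ 2 * d + eta).
  rewrite -eig // mulr_sumr.
  apply: (@le_trans _ _ (\sum_(i in S) (2 * s * alpha * x u * (e u i)%:R +
    (1 - alpha) * ((e u i)%:R * (x i ^+ 2 - s ^+ 2) + 2 * s ^+ 2 * (e u i)%:R)))).
    apply: ler_sum => i _.
    have : 0 <= (e u i)%:R * ((1 - alpha) * (x i - s) ^+ 2).
      by apply: mulr_ge0; [exact: ler0n|apply: mulr_ge0; [lra|exact: sqr_ge0]].
    lra.
  rewrite big_split /= -!mulr_sumr big_split /= -!mulr_sumr -degree_in_sum -/d.
  rewrite lerD2l; apply: ler_wpM2l; first by rewrite subr_ge0.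
  lra.
have d_le : (1 - alpha) * (2 * s ^+ 2 * d + eta) <=
    (1 - alpha) * (2 * (s * x u) * d) + eta.
  have h1 : (1 - alpha) * (s ^+ 2 * d) <= (1 - alpha) * (s * x u * d).
    by rewrite ler_wpM2l ?subr_ge0 // ler_wpM2r.
  have h2 : 0 <= alpha * eta by rewrite mulr_ge0.
  lra.
have eta_small : eta <= 2 * (s * x u) * (eta * #|S|%:R).
  have h1 : eta * #|S|%:R * s ^+ 2 <= eta * #|S|%:R * (s * x u).
    by rewrite ler_wpM2l // mulr_ge0.
  have h2 : eta * (1 - eta) <= eta * (#|S|%:R * s ^+ 2) by rewrite ler_wpM2l.
  have h3 : eta * eta <= eta * (1 / 2) by rewrite ler_wpM2l.
  lra.
have sx_gt0 : 0 < 2 * (s * x u) by rewrite !mulr_gt0 // (lt_le_trans s_gt0).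
rewrite -(ler_pM2l sx_gt0); lra.
Qed.

(** Symmetrised in i and j, twice the form is a sum over adjacent ordered pairs of alpha (x_i^2 +
    x_j^2) + 2 (1 - alpha) x_i x_j, each at most x_i^2 + x_j^2. *)
Lemma alpha_form_le_card (R : realType) (T : finType) (e : rel T) (alpha : R)
    (S : {set T}) (x : T -> R) :
  symmetric e -> 0 <= alpha <= 1 ->
  alpha_form e alpha S x <= #|S|%:R * sqnorm S x.
Proof.
move=> esym /andP[alpha_ge0 alpha_le1].
have sum_l : \sum_(i in S) \sum_(j in S) (x i ^+ 2) = #|S|%:R * sqnorm S x.
  rewrite mulr_sumr; apply: eq_bigr => i _; by rewrite sumr_const mulr_natl.
have sum_r : \sum_(i in S) \sum_(j in S) (x j ^+ 2) = #|S|%:R * sqnorm S x.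
  by rewrite sumr_const mulr_natl.
have : 2 * alpha_form e alpha S x <=
    \sum_(i in S) \sum_(j in S) (x i ^+ 2) + \sum_(i in S) \sum_(j in S) (x j ^+ 2).
  have -> : 2 * alpha_form e alpha S x = alpha_form e alpha S x +
      \sum_(i in S) \sum_(j in S) x j * ((e i j)%:R * (alpha * x j + (1 - alpha) * x i)).
    rewrite mulrDl !mul1r; congr (_ + _); rewrite exchange_big /=.
    by apply: eq_bigr => i _; rewrite mulr_sumr; apply: eq_bigr => j _; rewrite esym.
  rewrite -!big_split; apply: ler_sum => i _ /=.
  rewrite mulr_sumr -!big_split; apply: ler_sum => j _ /=.
  case: (e i j); have := sqr_ge0 (x i - x j); have := sqr_ge0 (x i + x j) => /=.
    move=> hp hm; have h1 := mulr_ge0 alpha_ge0 hm.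
    have h2 : 0 <= (1 - alpha) * (x i - x j) ^+ 2 by rewrite mulr_ge0 // subr_ge0.
    lra.
  lra.
rewrite sum_l sum_r; lra.
Qed.

(** * Iterated deletion and the harmonic series *)

(** [harmonic] is indexed from 0, so [series harmonic m] is 1 + 1/2 + ... + 1/m. *)
Lemma harmonicS (R : realType) (m : nat) :
  series (@harmonic R) m.+1 = series harmonic m + m.+1%:R^-1.
Proof. by rewrite !seriesEnat /= big_nat_recr. Qed.

Lemma harmonic_unbounded (R : realType) (C : R) :
  exists m0 : nat, forall m, (m0 <= m)%N -> C <= series harmonic m.
Proof.
have ndh : nondecreasing_seq (series (@harmonic R)).
  by apply: nondecreasing_series => i _ _; apply: harmonic_ge0.
suff [m0 Cm0] : exists m0, C <= series (@harmonic R) m0.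
  by exists m0 => m /ndh; apply: le_trans.
apply: boolp.contrapT => /boolp.forallNP bounded.
apply: (@dvg_harmonic R); apply: nondecreasing_is_cvgn => //.
exists C => _ [m _ <-]; apply: ltW; rewrite ltNge; apply/negP; exact: bounded.
Qed.

(** If the maximum a for [S] broke the claim, a nearly constant maximiser would contradict the
    vertex of small degree; for any other, deleting the vertex v with the least entry leaves a form
    exceeding the bound given by [B], in which |S| - 1 is the size of [S :\ v]. *)
Lemma deletion_step (R : realType) (n : nat) (e : rel 'I_n) (alpha beta eta kappa B : R)
    (S : {set 'I_n}) :
  symmetric e -> irreflexive e -> 0 <= alpha <= 1 -> 0 < eta <= 1 / 2 ->
  2 * kappa <= eta * (beta - alpha) -> 1 <= kappa * #|S|%:R -> 0 <= kappa ->
  (exists2 u, u \in S & (degree_in e S u)%:R < (beta - eta) * #|S|%:R) ->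
  (forall v, v \in S -> forall y, alpha_form e alpha (S :\ v) y <=
     B * (#|S|%:R - 1) * sqnorm (S :\ v) y) ->
  forall y, alpha_form e alpha S y <=
    Num.max beta (B - kappa / #|S|%:R) * #|S|%:R * sqnorm S y.
Proof.
move=> esym eirr alpha01 /andP[eta_gt0 eta_le] kappa_le kappa_S kappa_ge0.
move=> [u0 u0S small_deg] IH y.
have S0 : S != finset.set0 by apply/set0Pn; exists u0.
have [x [a [x_ge0 x1 eig max_a]]] := perron_exists esym alpha01 S0.
apply: le_trans (max_a y) _; apply: ler_wpM2r; first exact: sqnorm_ge0.
rewrite leNgt; apply/negP => a_gt.
have N_gt0 : 0 < #|S|%:R :> R by rewrite ltr0n card_gt0.
have N_ge1 : 1 <= #|S|%:R :> R by rewrite ler1n card_gt0.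
have a_beta : beta * #|S|%:R < a.
  by apply: le_lt_trans a_gt; rewrite ler_wpM2r ?le_max ?lexx // ltW.
have a_B : B * #|S|%:R - kappa < a.
  apply: le_lt_trans a_gt.
  apply: (@le_trans _ _ ((B - kappa / #|S|%:R) * #|S|%:R)).
    by rewrite mulrBl divfK ?gt_eqF.
  by rewrite ler_wpM2r ?le_max ?lexx ?orbT // ltW.
have form_a : alpha_form e alpha S x = a.
  rewrite -[RHS]mulr1 -x1 mulr_sumr; apply: eq_bigr => i iS.
  by rewrite eig // expr2 mulrCA.
have a_le : a <= #|S|%:R.
  by have := alpha_form_le_card S x esym alpha01; rewrite form_a x1 mulr1.
pose v := [arg min_(i < u0 in S) x i]%O.
have [vS min_v] : v \in S /\ forall i, i \in S -> x v <= x i.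
  by rewrite /v; case: arg_minP => // i iS le_i; split.
have := sum_adj_le e v (x_ge0 v) min_v; rewrite x1 => adj_le.
have del := alpha_form_delete alpha x esym eirr vS.
have sq_del : sqnorm (S :\ v) x = 1 - x v ^+ 2.
  by rewrite -x1 /sqnorm (big_setD1 v vS) /= addrC addrK.
have := IH v vS x; rewrite sq_del => IHx.
have s2_le1 : x v ^+ 2 <= 1 by rewrite -x1 sqr_le_sqnorm.
have s2_ge0 := sqr_ge0 (x v).
have Ns2_le1 : #|S|%:R * x v ^+ 2 <= 1.
  rewrite -[leRHS]x1 mulr_natl -sumr_const; apply: ler_sum => i iS.
  by rewrite ler_pXn2r ?nnegrE ?min_v.
move: alpha01 => /andP[alpha_ge0 alpha_le1].
have [unif|nonunif] := leP (1 - eta) (#|S|%:R * x v ^+ 2).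
  have xv_gt0 : 0 < x v.
    rewrite lt_neqAle x_ge0 andbT eq_sym; apply/eqP => xv0.
    by move: unif; rewrite xv0 expr0n mulr0; lra.
  have := @near_uniform_degree _ _ e alpha eta a (x v) S x _ _ xv_gt0 min_v x1 eig unif u0 u0S.
  rewrite alpha_ge0 alpha_le1 (ltW eta_gt0) eta_le => /(_ isT isT).
  by rewrite leNgt => /negP; apply; lra.
move: del; rewrite form_a eig // => del.
have alpha_adj := ler_wpM2l alpha_ge0 adj_le.
move: (#|S|%:R : R) (x v) IHx del alpha_adj N_gt0 N_ge1 a_beta a_B a_le s2_le1 s2_ge0 Ns2_le1
  nonunif kappa_S => N s.
move: (alpha_form _ _ _ _) (\sum_(i in S) _) => F Sig {small_deg adj_le sq_del IH a_gt max_a}.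
move=> IHx del alpha_adj N_gt0 N_ge1 a_beta a_B a_le s2_le1 s2_ge0 Ns2_le1 nonunif kappa_S.
set s2 := s ^+ 2 in IHx alpha_adj s2_le1 s2_ge0 Ns2_le1 nonunif.
have ss : s * (a * s) = a * s2 by rewrite /s2; lra.
(* Multiplied by N and combined with B N < a + kappa, this becomes (1 - N s2) (a - alpha N) <= a s2
   + kappa (N - 1) (1 - s2). The left side is at least eta (beta - alpha) N >= 2 kappa N; the right
   side is less than 2 kappa N, because a s2 <= N s2 < 1 <= kappa N. *)
have h1 : a <= B * (N - 1) * (1 - s2) + 2 * (a * s2) + alpha * (1 - N * s2) by lra.
have h2 : (B * N) * ((N - 1) * (1 - s2)) <= (a + kappa) * ((N - 1) * (1 - s2)).
  by apply: ler_wpM2r; [apply: mulr_ge0; lra|lra].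
have h3 := ler_wpM2l (ltW N_gt0) h1.
have h4 : (1 - N * s2) * ((beta - alpha) * N) <= (1 - N * s2) * (a - alpha * N).
  by apply: ler_wpM2l; lra.
have ba_gt0 : 0 <= (beta - alpha) * N.
  apply: mulr_ge0; last exact: ltW.
  by rewrite -(@pmulr_rge0 _ eta) //; apply: le_trans kappa_le; lra.
have h5 : eta * ((beta - alpha) * N) <= (1 - N * s2) * ((beta - alpha) * N).
  by apply: ler_wpM2r => //; lra.
have h6 := ler_wpM2r (ltW N_gt0) kappa_le.
have h7 : a * s2 <= N * s2 by apply: ler_wpM2r.
have h8 : kappa * s2 <= kappa * 1 by apply: ler_wpM2l.
have h9 : 0 <= kappa * (N * s2) by apply: mulr_ge0 => //; apply: mulr_ge0 => //; apply: ltW.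
lra.
Qed.

(** Induction on |S| - M from the trivial bound |S|: each [deletion_step] gains kappa / |S|, and the
    gains add up to a difference of harmonic numbers. *)
Lemma alpha_form_bound (R : realType) (n : nat) (e : rel 'I_n)
    (alpha beta eta kappa : R) (M : nat) :
  symmetric e -> irreflexive e -> 0 <= alpha <= 1 -> 0 < eta <= 1 / 2 ->
  2 * kappa <= eta * (beta - alpha) -> 1 <= kappa * M%:R -> 0 <= kappa ->
  (forall S : {set 'I_n}, (M <= #|S|)%N ->
     exists2 u, u \in S & (degree_in e S u)%:R < (beta - eta) * #|S|%:R) ->
  forall S : {set 'I_n}, (M <= #|S|)%N -> forall y, alpha_form e alpha S y <=
    Num.max beta (1 - kappa * (series harmonic #|S| - series harmonic M)) * #|S|%:R
      * sqnorm S y.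
Proof.
move=> esym eirr alpha01 eta01 kappa_le kappa_M kappa_ge0 small_deg S MS.
have [k cardS] : exists k, #|S| = (M + k)%N by exists (#|S| - M)%N; rewrite subnKC.
elim: k => [|k IHk] in S MS cardS * => y.
  apply: le_trans (alpha_form_le_card S y esym alpha01) _.
  apply: ler_wpM2r; first exact: sqnorm_ge0.
  by rewrite cardS addn0 subrr mulr0 subr0 ler_peMl // le_max lexx orbT.
pose B := Num.max beta (1 - kappa * (series harmonic (M + k) - series harmonic M)).
have kappa_S : 1 <= kappa * #|S|%:R.
  by apply: le_trans kappa_M _; rewrite ler_wpM2l // ler_nat.
apply: (le_trans (deletion_step (B := B) esym eirr alpha01 eta01 kappa_le kappa_S
  kappa_ge0 (small_deg S MS) _ y)) => [v vS|].
  have card_del : #|S :\ v| = (M + k)%N.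
    by move: (cardsD1 v S); rewrite vS cardS addnS add1n => -[].
  have := IHk (S :\ v); rewrite card_del leq_addr => /(_ isT erefl).
  suff -> : #|S|%:R - 1 = (M + k)%:R :> R by [].
  by rewrite cardS addnS -natr1 addrK.
apply: ler_wpM2r; first exact: sqnorm_ge0.
apply: ler_wpM2r => //; rewrite ge_max le_max lexx /=.
rewrite /B cardS addnS harmonicS.
rewrite lerBlDr ge_max; set X := 1 - kappa * (_ + _ - _); apply/andP; split.
  by apply: ler_wpDr; rewrite ?le_max ?lexx // divr_ge0.
apply: (@le_trans _ _ (X + kappa / (M + k).+1%:R)).
  by rewrite /X !mulrBr mulrDr; move: (_^-1) => q; lra.
by rewrite lerD2r le_max lexx orbT.
Qed.

(** * Upper bound for graphs without a large blow-up *)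

Lemma blowup_free_alpha_form_le (R : realType) (r t : nat) (alpha eps : R) :
  (0 < r)%N -> 0 < eps <= 1 -> 0 <= alpha <= 1 - r%:R^-1 ->
  exists n0 : nat, forall (n : nat) (e : rel 'I_n), (n0 <= n)%N ->
    symmetric e -> irreflexive e -> ~ (exists B, blowup_in e [set: 'I_n] r.+1 t B) ->
    forall y, alpha_form e alpha [set: 'I_n] y <=
      (1 - r%:R^-1 + eps) * n%:R * sqnorm [set: 'I_n] y.
Proof.
move=> r_gt0 /andP[eps_gt0 eps_le1] /andP[alpha_ge0 alpha_le].
have rV_gt0 : (0 : R) < r%:R^-1 by rewrite invr_gt0 ltr0n.
have rV_le1 : (r%:R^-1 : R) <= 1 by rewrite invf_le1 ?ltr0n // ler1n.
have eps2_gt0 : 0 < eps / 2 by rewrite divr_gt0.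
have [m0 ES] := erdos_stone_min_degree r_gt0 eps2_gt0 t (leqnn r.+1).
(* Below, eta = eps / 2, and alpha <= 1 - 1/r gives beta - alpha >= eps, so that 2 kappa <= eta
   (beta - alpha). *)
pose kappa := eps ^+ 2 / 4.
have kappa_gt0 : 0 < kappa by rewrite divr_gt0 // exprn_gt0.
have [m1 kappa_m1] := exists_nat_mul_ge 1 kappa_gt0.
pose M := maxn m0 m1.
(* For n >= n1 the total gain kappa (H_n - H_M) is at least 1, so the maximum in [alpha_form_bound]
   is [beta]. *)
have [n1 n1P] := harmonic_unbounded (kappa^-1 + series (@harmonic R) M).
exists (maxn M n1) => n e; rewrite geq_max => /andP[Mn n1n] esym eirr free y.
pose beta : R := 1 - r%:R^-1 + eps.
have bound (S : {set 'I_n}) : (M <= #|S|)%N -> forall z, alpha_form e alpha S z <=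
    Num.max beta (1 - kappa * (series harmonic #|S| - series harmonic M)) * #|S|%:R
      * sqnorm S z.
  apply: (@alpha_form_bound R n e alpha beta (eps / 2)) => //.
  - by rewrite alpha_ge0 /=; lra.
  - by rewrite eps2_gt0 /=; lra.
  - rewrite /kappa /beta; have : 0 <= eps * (1 - r%:R^-1 - alpha).
      by rewrite mulr_ge0 ?subr_ge0 // ltW.
    lra.
  - by apply: le_trans kappa_m1 _; rewrite ler_wpM2l ?(ltW kappa_gt0) // ler_nat leq_maxr.
  - exact: ltW.
  (* If all degrees in [S] were at least (beta - eps / 2) |S|, a surplus of eps / 2 over 1 - 1/r
     would remain for the Erdos-Stone theorem. *)
  - move=> {}S MS; apply/exists_inP; rewrite -[X in is_true X]negbK negb_exists_in.
    apply/negP => /forall_inP large; apply: free.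
    have [|u uS|B blB] := ES _ e S esym; first exact: leq_trans (leq_maxl _ _) MS.
      by have := large u uS; rewrite -leNgt; apply: le_trans; rewrite ler_wpM2r // /beta; lra.
    exists B; case: blB => blB1 blB2; split=> // i ir.
    by have [_ ->] := blB1 i ir; rewrite finset.subsetT.
have := bound [set: 'I_n]%SET; rewrite cardsT card_ord => /(_ Mn y).
move=> H; apply: le_trans H _; apply: ler_wpM2r; first exact: sqnorm_ge0.
  apply: ler_wpM2r => //; rewrite ge_max lexx /=.
  apply: (@le_trans _ _ 0); last by lra.
  rewrite subr_le0 -ler_pdivrMl // mulr1 lerBrDr; exact: n1P.
Qed.

(** * Embedding colourable graphs, and eigenvalues through the form *)

(** Vertex i goes to the i-th element of the class of its colour. Vertices of different colours have
    adjacent, hence distinct, images. *)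
Lemma blowup_contains (G H : graph) (k : nat) B :
  colorable H k -> blowup_in (@gadj G) [set: 'I_(gv G)] k (gv H) B -> contains G H.
Proof.
move=> /existsP[c /forallP c_proper] blB; have [cardB _] := blB.
have cardBc (p : 'I_k) : gv H = #|B p| by have [_ ->] := cardB p (ltn_ord p).
pose f i := enum_val (cast_ord (cardBc (c i)) i).
have fB i : f i \in B (c i) by apply: enum_valP.
have adj i j : c i != c j -> gadj (f i) (f j).
  by move=> cij; apply: (blowup_adj (@gsym G) blB) (fB i) (fB j).
exists f; split=> [i j fij|i j ij]; last first.
  by apply: adj; move/forallP: (c_proper i) => /(_ j) /implyP; apply.
have [cij|/adj] := eqVneq (c i) (c j); last by rewrite fij girr.
move: fij; rewrite /f; case: _ / cij => /enum_val_inj; exact: cast_ord_inj.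
Qed.

(** [eigenvalue] refers to row vectors multiplied from the left; symmetry of the adjacency
    identifies this product with [alpha_op]. *)
Lemma mulmx_Aalpha (R : realType) (alpha : R) (G : graph) (v : 'rV[R]_(gv G)) j :
  (v *m Aalpha alpha G) ord0 j = alpha_op (@gadj G) alpha [set: 'I_(gv G)] (v ord0) j.
Proof.
rewrite /alpha_op mxE; under [RHS]eq_bigl do rewrite inE.
transitivity (\sum_i (v ord0 i * (alpha * degmx R G i j)) +
              \sum_i (v ord0 i * ((1 - alpha) * adjmx R G i j))).
  by rewrite -big_split; apply: eq_bigr => i _; rewrite !mxE mulrDr.
rewrite (bigD1 j) //= big1 ?addr0 => [|i /negbTE ij]; last first.
  by rewrite !mxE ij mulr0n !mulr0.
rewrite !mxE eqxx mulr1n !mulr_sumr -big_split; apply: eq_bigr => i _ /=.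
by rewrite !mxE (gsym i j); lra.
Qed.

Lemma eigenvalue_Aalpha_le (R : realType) (alpha : R) (G : graph) (a b : R) :
  (forall y, alpha_form (@gadj G) alpha [set: 'I_(gv G)] y <= b * sqnorm [set: 'I_(gv G)] y) ->
  eigenvalue (Aalpha alpha G) a -> a <= b.
Proof.
move=> form_le /eigenvalueP[v va v0].
have := form_le (v ord0).
have -> : alpha_form (@gadj G) alpha [set: 'I_(gv G)] (v ord0) =
    a * sqnorm [set: 'I_(gv G)] (v ord0).
  rewrite mulr_sumr; apply: eq_bigr => j _.
  by rewrite -mulmx_Aalpha va mxE expr2 mulrCA.
rewrite ler_pM2r // lt_neqAle sqnorm_ge0 andbT eq_sym.
apply: contra_neq v0 => sq0; apply/rowP => j; rewrite mxE; apply/eqP.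
by rewrite -sqrf_eq0 eq_le sqr_ge0 andbT -sq0 sqr_le_sqnorm ?inE.
Qed.

(** * Colourings and the lower-bound graph *)

Lemma contains_chi_le (G H : graph) (k : nat) :
  contains G H -> colorable G k -> (chi H <= k)%N.
Proof.
move=> [f [_ f_hom]] /existsP[c /forallP c_proper].
rewrite /chi; case: ex_minnP => m _; apply; apply/existsP; exists [ffun i => c (f i)].
apply/forallP => i; apply/forallP => j; apply/implyP => ij; rewrite !ffunE.
by move/forallP: (c_proper (f i)) => /(_ (f j)) /implyP; apply; apply: f_hom.
Qed.

Lemma colorable_chi (H : graph) : colorable H (chi H).
Proof. by rewrite /chi; case: ex_minnP. Qed.

(* [r] classes of exactly [n %/ r] vertices each, the remaining [n %% r] vertices being
   isolated: unlike in the Turan graph, all non-isolated vertices have the same degree,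
   so that their indicator function is an eigenvector for every [alpha]. *)
Definition multipartite_rel (n r : nat) : rel 'I_n := fun i j =>
  [&& (i < n %/ r * r)%N, (j < n %/ r * r)%N & (i %% r != j %% r)%N].

Lemma multipartite_sym (n r : nat) : symmetric (@multipartite_rel n r).
Proof. by move=> i j; rewrite /multipartite_rel eq_sym andbCA. Qed.

Lemma multipartite_irr (n r : nat) : irreflexive (@multipartite_rel n r).
Proof. by move=> i; rewrite /multipartite_rel eqxx !andbF. Qed.

Definition multipartite (n r : nat) : graph :=
  Graph (@multipartite_sym n r) (@multipartite_irr n r).

Lemma multipartite_colorable (n r : nat) : (0 < r)%N -> colorable (multipartite n r) r.
Proof.
move=> r_gt0; apply/existsP.
exists [ffun i : 'I_n => Ordinal (ltn_pmod i r_gt0)].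
apply/forallP => i; apply/forallP => j; apply/implyP => /and3P[_ _ ij].
by rewrite !ffunE.
Qed.

Lemma sum_mod_neq (r m c : nat) :
  (c < r)%N -> (\sum_(0 <= i < m * r) (c != i %% r) = m * r.-1)%N.
Proof.
move=> cr; elim: m => [|m IHm]; first by rewrite !mul0n big_geq.
rewrite mulSn addnC (@big_cat_nat _ _ _ (m * r)) ?leq_addr //= IHm mulSn addnC.
congr (_ + _)%N; rewrite -{1}[(m * r)%N]add0n big_addn addKn big_mkord.
rewrite (eq_bigr (fun i : 'I_r => (i != Ordinal cr) : nat)) => [|i _].
  rewrite -[r in RHS](card_ord r) -(cardC1 (Ordinal cr)) -sum1_card [RHS]big_mkcond.
  by apply: eq_bigr => i _; rewrite !inE; case: eqP.
by rewrite addnC modnMDl modn_small // -val_eqE /= eq_sym.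
Qed.

Lemma multipartite_eigenvalue (R : realType) (alpha : R) (n r : nat) :
  (0 < r <= n)%N ->
  eigenvalue (Aalpha alpha (multipartite n r)) (n %/ r * r.-1)%:R.
Proof.
move=> /andP[r_gt0 rn].
have mr_le : (n %/ r * r <= n)%N by apply: leq_divM.
have mr_gt0 : (0 < n %/ r * r)%N by rewrite muln_gt0 divn_gt0 ?r_gt0 ?andbT.
pose v : 'rV[R]_n := \row_i (i < n %/ r * r)%N%:R.
apply/eigenvalueP; exists v; last first.
  apply/eqP => /rowP /(_ (Ordinal (leq_trans mr_gt0 mr_le))).
  by rewrite !mxE /= mr_gt0 => /eqP; rewrite oner_eq0.
apply/rowP => j; rewrite mulmx_Aalpha !mxE /alpha_op.
(* Adjacent vertices both have entry 1 in [v], and alpha + (1 - alpha) = 1, so entry j counts the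
   neighbours of j. *)
transitivity ((\sum_(i < n) multipartite_rel r j i)%N%:R : R).
  rewrite natr_sum; apply: eq_big => [i|i _]; first by rewrite inE.
  rewrite !mxE /= /multipartite_rel.
  case: (j < _)%N; case: (i < _)%N; case: (_ != _) => /=; lra.
rewrite -natrM; congr (_%:R); rewrite /multipartite_rel.
case: ltnP => jr /=; last by rewrite big1 ?muln0.
rewrite muln1 -(@sum_mod_neq r _ (j %% r)) ?ltn_pmod //.
rewrite -(big_mkord xpredT (fun i => ((i < n %/ r * r) && (j %% r != i %% r) : nat))%N).
rewrite (@big_cat_nat _ _ _ (n %/ r * r)) //= [X in (_ + X)%N]big_nat_cond.
rewrite [X in (_ + X)%N]big1 ?addn0 => [|i /andP[/andP[ri _] _]]; last by rewrite ltnNge ri.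
by apply: eq_big_nat => i /andP[_ ->].
Qed.

(** * The asymptotic formula *)

Theorem theorem2p1 (R : realType) (fam : graph -> Prop) (r : nat) (alpha : R) :
  (2 <= r)%N ->
  (exists H, fam H /\ chi H = r.+1) ->
  (forall H, fam H -> (r.+1 <= chi H)%N) ->
  0 <= alpha -> alpha <= 1 - r%:R^-1 ->
  (fun n : nat => ex_alpha alpha n fam / n%:R) @ \oo --> (1 - r%:R^-1 : R).
Proof.
move=> r_ge2 [H [famH chiH]] chi_fam alpha_ge0 alpha_le.
have r_gt0 : (0 < r)%N := ltnW r_ge2.
have rR_gt0 : 0 < r%:R :> R by rewrite ltr0n.
apply/cvgrPdist_le => eps0 eps0_gt0.
pose eps := Num.min eps0 1.
have eps_gt0 : 0 < eps by rewrite lt_min eps0_gt0 ltr01.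
have eps01 : 0 < eps <= 1 by rewrite eps_gt0 ge_min lexx orbT.
have eps_le : eps <= eps0 by rewrite ge_min lexx.
have alpha01 : 0 <= alpha <= 1 - r%:R^-1 by rewrite alpha_ge0.
have [n0 n0P] := blowup_free_alpha_form_le (gv H) r_gt0 eps01 alpha01.
(* For n >= n1 we have r <= eps n, which absorbs the rounding loss in [n %/ r]. *)
have [n1 n1P] := exists_nat_mul_ge r%:R eps_gt0.
exists (n0 + n1 + r)%N => // n /= n_large.
have n0n : (n0 <= n)%N by apply: leq_trans n_large; rewrite -addnA leq_addr.
have rn : (r <= n)%N by apply: leq_trans n_large; rewrite leq_addl.
have n_gt0 : 0 < n%:R :> R by rewrite ltr0n (leq_trans r_gt0).
have r_le_eps : r%:R <= eps * n%:R.
  apply: le_trans n1P _; rewrite ler_wpM2l ?(ltW eps_gt0) // ler_nat.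
  by apply: leq_trans n_large; rewrite addnAC leq_addl.
set c : R := 1 - r%:R^-1.
have c_ge0 : 0 <= c by apply: le_trans alpha_le.
have eig_le (G : graph) a : gv G = n -> F_free fam G ->
    eigenvalue (Aalpha alpha G) a -> a <= (c + eps) * n%:R.
  move=> Gn freeG; apply: eigenvalue_Aalpha_le; rewrite -Gn.
  apply: n0P; [by rewrite Gn|exact: gsym|exact: girr|].
  (* [H] is (r+1)-colourable, so it embeds in any blow-up with r + 1 classes of size [gv H]. *)
  move=> [B blB]; apply: (freeG H famH); apply: blowup_contains blB.
  by rewrite -chiH colorable_chi.
have lambda_le (G : graph) : gv G = n -> F_free fam G ->
    lambda_alpha alpha G <= (c + eps) * n%:R.
  move=> Gn freeG; rewrite /lambda_alpha.
  (* For an empty set of eigenvalues [sup] is 0, and the bound is nonnegative. *)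
  have [->|/set0P ne] := eqVneq [set a : R | eigenvalue (Aalpha alpha G) a] set0.
    by rewrite sup0; apply: mulr_ge0 => //; apply: addr_ge0 => //; apply: ltW.
  by apply: ge_sup => // a; apply: eig_le.
pose K := multipartite n r.
have freeK : F_free fam K.
  move=> F famF KF; have := contains_chi_le KF (multipartite_colorable n r_gt0).
  by rewrite leqNgt chi_fam.
have lambdaK : (n %/ r * r.-1)%:R <= lambda_alpha alpha K.
  apply: ub_le_sup; last by apply: multipartite_eigenvalue; rewrite r_gt0.
  by exists ((c + eps) * n%:R) => a; apply: eig_le.
pose E := [set lambda_alpha alpha G | G in [set G : graph | gv G = n /\ F_free fam G]].
have ub_E : ubound E ((c + eps) * n%:R) by move=> _ [G [Gn freeG] <-]; apply: lambda_le.
have E_K : E (lambda_alpha alpha K) by exists K.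
have ex_le : ex_alpha alpha n fam <= (c + eps) * n%:R.
  by apply: ge_sup => //; exists (lambda_alpha alpha K).
have ex_ge : (n %/ r * r.-1)%:R <= ex_alpha alpha n fam.
  by apply: le_trans lambdaK _; apply: ub_le_sup => //; exists ((c + eps) * n%:R).
(* As c r = r - 1, replacing n by r * (n %/ r) costs at most c r <= r. *)
have nr_ge : c * n%:R - r%:R <= (n %/ r * r.-1)%:R.
  have n_le : n%:R <= (n %/ r)%:R * r%:R + r%:R :> R.
    by rewrite -natrM -natrD ler_nat {1}(divn_eq n r) leq_add2l ltnW // ltn_pmod.
  have r1 : r.-1%:R = r%:R - 1 :> R by rewrite -subn1 natrB.
  have cr : c * r%:R = r%:R - 1 by rewrite mulrBl mul1r mulVf // gt_eqF.
  have h1 := ler_wpM2l c_ge0 n_le.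
  have h2 : c * ((n %/ r)%:R * r%:R) = (n %/ r)%:R * (r%:R - 1) by rewrite mulrCA cr.
  rewrite natrM r1; move: h1; rewrite mulrDr h2 cr; lra.
apply: le_trans eps_le; rewrite distrC ler_norml; apply/andP; split.
  rewrite lerBrDr ler_pdivlMr //; apply: le_trans ex_ge; apply: le_trans nr_ge.
  by rewrite mulrDl mulNr addrC lerD2l lerN2.
by rewrite lerBlDr ler_pdivrMr // addrC.
Qed.
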